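(* Let $X=GI(n;J)$ be any connected vertex-transitive $GI$-graph. Then: (a) If $\mathrm{Aut}(X)$ has a vertex-transitive subgroup that preserves the fundamental edge-partition of $X$, then $GI(n;[k]J)$ is vertex-transitive for every positive integer $k$. (b) All elements in $J\cup -J$ have the same multiplicity, say $k_0$, and the graph $X=GI(n;J)$ is isomorphic to $GI(n;[k_0]J_0)$ for some primitive subset $J_0$ of $\mathbb{Z}_n$ such that $GI(n;J_0)$ is vertex-transitive.
   Context: For integers $n\ge 3$, $t\ge 1$ and a sequence (or multiset) $J=\{j_0,\dots,j_{t-1}\}$ of integers with $0<j_k<n$ and $j_k\neq n/2$ (viewed mod $n$), the $GI$-graph $GI(n;J)=GI(n;j_0,\dots,j_{t-1})$ is the graph with vertex set $\mathbb{Z}_t\times\mathbb{Z}_n$ and two types of edges: spoke edges, joining $(s,v)$ to $(s',v)$ for all distinct $s,s'\in\mathbb{Z}_t$ and all $v\in\mathbb{Z}_n$; and layer edges, joining $(s,v)$ to $(s,v+j_s)$ and $(s,v-j_s)$ for all $s\in\mathbb{Z}_t$, $v\in\mathbb{Z}_n$. The fundamental edge-partition is the partition of the edge set into spoke edges and layer edges; a group of automorphisms preserves it if each of its elements takes spoke edges to spoke edges and layer edges to layer edges. $[k]J$ denotes the concatenation of $k$ copies of the multiset $J$. The multiplicity of $x$ in $J\cup -J$ is the number of $s\in\mathbb{Z}_t$ with $j_s=\pm x$ in $\mathbb{Z}_n$. A subset $J_0=\{j_0,\dots,j_{r-1}\}$ of $\mathbb{Z}_n$ (with no element equal to $0$ or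 $n/2$) is primitive if $1\in J_0$ and $j_i\neq\pm j_k$ whenever $i\neq k$. *)

(* Defs.v *)
From HB Require Import structures.
From mathcomp Require Import all_boot all_order all_algebra all_fingroup.

Set Implicit Arguments.
Unset Strict Implicit.
Unset Printing Implicit Defensive.

Import GRing.Theory.
Local Open Scope ring_scope.

Section Graph.

Variables (T : finType) (e : rel T).

Definition graph_aut : {set {perm T}} :=
  [set p : {perm T} | [forall x, forall y, e (p x) (p y) == e x y]].

Lemma graph_aut_group_set : group_set graph_aut.
Proof.
apply/group_setP; split=> [|p q].
  by rewrite inE; apply/forallP=> x; apply/forallP=> y; rewrite !perm1.
rewrite !inE => /forallP hp /forallP hq.
apply/forallP=> x; apply/forallP=> y; rewrite !permM.
by rewrite (eqP (forallP (hq _) _)) (eqP (forallP (hp _) _)).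
Qed.

Canonical graph_aut_group := Group graph_aut_group_set.

Definition vertex_transitive : bool :=
  [transitive graph_aut, on [set: T] | 'P].

Definition graph_connected : Prop := forall x y : T, connect e x y.

End Graph.

Definition graph_iso (T1 T2 : finType) (e1 : rel T1) (e2 : rel T2) : Prop :=
  exists2 f : T1 -> T2, bijective f & forall x y, e2 (f x) (f y) = e1 x y.

Section GIGraph.

Variable n : nat.

(* Neither 0 nor n/2.  Residues are represented in [0, n) only for 1 < n,
   which is assumed wherever this is used: 'Z_0 and 'Z_1 are 'Z_2. *)
Definition gi_admissible (j : 'Z_n) : bool :=
  (j != 0) && ((j : nat).*2 != n).

Variable J : seq 'Z_n.

(* The layers are indexed by the positions in J, so that repeated entries of J
   give distinct layers. *)
Definition gi_vertex : finType := ('I_(size J) * 'Z_n)%type.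

Definition gi_spoke : rel gi_vertex :=
  fun u v => (u.1 != v.1) && (u.2 == v.2).

Definition gi_layer : rel gi_vertex :=
  fun u v => (u.1 == v.1) &&
    ((v.2 == u.2 + J`_(u.1)) || (v.2 == u.2 - J`_(u.1))).

Definition GI : rel gi_vertex :=
  fun u v => gi_spoke u v || gi_layer u v.

Definition preserves_fundamental_partition (G : {set {perm gi_vertex}}) : Prop :=
  forall p : {perm gi_vertex}, p \in G -> forall u v : gi_vertex,
    (gi_spoke u v -> gi_spoke (p u) (p v)) /\
    (gi_layer u v -> gi_layer (p u) (p v)).

(* Counts positions s with J`_s = x or J`_s = - x; each position counts once. *)
Definition pm_multiplicity (x : 'Z_n) : nat :=
  count (fun j => (j == x) || (j == - x)) J.

End GIGraph.

Arguments GI {n} J.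

(* [k]J *)
Definition copies (T : Type) (k : nat) (J : seq T) : seq T :=
  flatten (nseq k J).

Definition primitive (n : nat) (J0 : {set 'Z_n}) : Prop :=
  [/\ {in J0, forall j, gi_admissible j},
      1 \in J0
    & {in J0 &, forall i j : 'Z_n, i != j -> i != - j}].

(* Main.v *)
Require Import Defs.
From HB Require Import structures.
From mathcomp Require Import all_boot all_order all_algebra all_fingroup.
From mathcomp Require Import zify.

Set Implicit Arguments.
Unset Strict Implicit.
Unset Printing Implicit Defensive.

Import GRing.Theory.
Local Open Scope ring_scope.

(** Everything passes through one arithmetic condition on J, [layer_transitive]:
    the units a of Z_n for which multiplication by a permutes the entries of J
    up to sign are transitive on these entries up to sign.

    The condition is sufficient for vertex-transitivity
    ([layer_transitive_VT]): such a unit gives an automorphism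
    (k, v) |-> (f k, a v + b), and b moves every point of a layer to every other
    one. It mentions only the multiplicities of the entries, so it passes from J
    to its copies and to a set J0 of representatives of u^-1 J up to sign; and it
    forces all multiplicities to agree.

    The condition is necessary for a vertex-transitive group that preserves the
    fundamental edge-partition. Such an automorphism p carries the walk
    v, v + J_s, v + 2 J_s, ... along a layer to a walk of the same kind with a
    constant step ([gi_layer_walk]). Hence all entries of J have the same
    annihilator, so that gcd(n, J_s) divides every entry; connectedness makes it
    1, and every entry is a unit ([partition_preserving_unit]). Each layer is
    then one cycle, p is affine on it, and the spokes force the slopes on the
    layers to agree ([partition_preserving_affine]). This gives (a), and also (b)
    whenever Aut(X) preserves the partition.

    For (b) in general, let t be the number of layers.
    - If J has only one entry up to sign, connectedness makes it a unit and the
      arithmetic condition is trivial. This covers t = 1.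
    - If t >= 3, every spoke lies in a triangle, whereas a layer edge of layer s
      does only if 3 J_s = 0. By vertex-transitivity 3 J_s = 0 for every s or for
      none. In the first case J has one entry up to sign; in the second the spokes
      are the edges that lie in triangles, so the partition is preserved.
    - If t = 2 with J_0 and J_1 different up to sign and one of them a unit u,
      all multiplicities are 1, and X itself is GI(n; J0) after division by u.
    - If t = 2 and neither entry is a unit, the numbers gcd(n, J_0) and
      gcd(n, J_1) are coprime and greater than 1, which excludes almost all
      closed walks of length 8 that do not backtrack. A path of two layer edges
      extends to at most one such walk, which stays in its layer
      ([closed_walk8_layer]), while a path of a spoke and a layer edge extends to
      two ([closed_commutator_walk]). Hence the partition is preserved, and the
      entries are units after all, a contradiction. *)

(** * Automorphisms, residues up to sign, multiplicities *)

Lemma vertex_transitiveI (T : finType) (e : rel T) (x0 : T) :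
  (forall x y : T, exists F : T -> T,
     [/\ bijective F, forall u v, e (F u) (F v) = e u v & F x = y]) ->
  vertex_transitive e.
Proof.
move=> h; apply/imsetP; exists x0 => //.
apply/setP=> y; rewrite inE; symmetry; apply/orbitP.
have [F [bF eF <-]] := h x0 y.
exists (perm (bij_inj bF)); last by rewrite /= apermE permE.
by rewrite inE; apply/forallP=> u; apply/forallP=> v; rewrite !permE eF.
Qed.

Lemma vertex_transitiveE (T : finType) (G : {group {perm T}}) :
  [transitive G, on [set: T] | 'P] ->
  forall x y : T, exists2 p : {perm T}, p \in G & p x = y.
Proof.
move=> tr x y.
have [p pG ->] := atransP2 tr (in_setT x) (in_setT y).
by exists p.
Qed.

Lemma graph_autE (T : finType) (e : rel T) (p : {perm T}) :
  p \in graph_aut e -> forall x y, e (p x) (p y) = e x y.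
Proof. by rewrite inE => /forallP h x y; apply/eqP; apply: (forallP (h x)). Qed.

Lemma vertex_transitive_iso (T1 T2 : finType) (e1 : rel T1) (e2 : rel T2) :
  graph_iso e1 e2 -> T1 -> vertex_transitive e1 -> vertex_transitive e2.
Proof.
move=> [f [g fK gK] fe] x0 vt; apply: (vertex_transitiveI (f x0)) => x y.
have [p pA pxy] := vertex_transitiveE vt (g x) (g y).
exists (f \o p \o g); split=> [|u v|] /=; last by rewrite pxy gK.
  by exists (f \o (p^-1)%g \o g) => u /=; rewrite fK ?permK ?permKV gK.
by rewrite fe (graph_autE pA) -fe !gK.
Qed.

Section Residues.

Variable n : nat.
Hypothesis n_gt1 : (1 < n)%N.
Implicit Types (x y z : 'Z_n) (J : seq 'Z_n).

Lemma val_ltn x : (x < n)%N.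
Proof. by have := ltn_ord x; rewrite {2}(Zp_cast n_gt1). Qed.

Lemma natr_Z_eq0 k : ((k%:R : 'Z_n) == 0) = (n %| k)%N.
Proof. by rewrite -(inj_eq val_inj) /= (val_Zp_nat n_gt1). Qed.

Lemma gi_admissibleE x : gi_admissible x = (x != - x).
Proof.
have xn := val_ltn x.
rewrite /gi_admissible -addr_eq0 -[x in x + x]natr_Zp -natrD natr_Z_eq0.
rewrite -[x != 0]negbK negbK -(inj_eq val_inj) /=.
case: (val x) xn => [|k] /= xn.
  by rewrite dvdn0.
rewrite addnn; congr negb; apply/eqP/idP=> [->//|/dvdnP[q hq]].
case: q hq => [|[|q]]; nia.
Qed.

Lemma unit_coprime x : (x \is a GRing.unit) = coprime n x.
Proof. by rewrite -{1}[x]natr_Zp unitZpE. Qed.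

(** A choice between x and - x that is the same for both, so that counting up to
    sign becomes counting equal values. *)
Definition abs_Z x : 'Z_n := if (x <= - x)%N then x else - x.

Lemma abs_ZP x : abs_Z x = x \/ abs_Z x = - x.
Proof. by rewrite /abs_Z; case: ifP; [left | right]. Qed.

Lemma abs_ZN x : abs_Z (- x) = abs_Z x.
Proof.
rewrite /abs_Z opprK; case: leqP => h1; case: leqP => h2 //.
  by apply/val_inj/eqP; rewrite eqn_leq h1 h2.
by have := ltn_trans h1 h2; rewrite ltnn.
Qed.

Lemma abs_Z_eq x y : (abs_Z x == abs_Z y) = (x == y) || (x == - y).
Proof.
apply/eqP/orP=> [|[/eqP-> | /eqP->]] //; last by rewrite abs_ZN.
case: (abs_ZP x) (abs_ZP y) => [->|->] [->|->]; first by left; apply/eqP.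
- by right; apply/eqP.
- by move/eqP; rewrite eqr_oppLR; right.
by move/oppr_inj; left; apply/eqP.
Qed.

Lemma abs_ZK x : abs_Z (abs_Z x) = abs_Z x.
Proof. by case: (abs_ZP x) => e; rewrite !e ?abs_ZN ?e. Qed.

Lemma eq_abs_Z x y : abs_Z x = abs_Z y -> x = y \/ x = - y.
Proof. by move/eqP; rewrite abs_Z_eq => /orP[]/eqP; [left | right]. Qed.

Lemma abs_ZM a x y : abs_Z x = abs_Z y -> abs_Z (a * x) = abs_Z (a * y).
Proof. by case/eq_abs_Z=> ->; rewrite ?mulrN ?abs_ZN. Qed.

Lemma pm_multiplicityE J z :
  pm_multiplicity J z = count (fun x => abs_Z x == abs_Z z) J.
Proof. by apply: eq_count => x; rewrite abs_Z_eq. Qed.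

Lemma pm_multiplicity_abs J x y :
  abs_Z x = abs_Z y -> pm_multiplicity J x = pm_multiplicity J y.
Proof. by rewrite !pm_multiplicityE => ->. Qed.

Lemma pm_multiplicity_gt0 J z :
  (0 < pm_multiplicity J z)%N = (z \in J) || (- z \in J).
Proof.
rewrite /pm_multiplicity -has_count; apply/hasP/orP.
  by case=> x xJ /orP[]/eqP<-; [left | right].
by case=> zJ; [exists z | exists (- z)] => //; rewrite eqxx ?orbT.
Qed.

Lemma pm_multiplicity_copies k J z :
  pm_multiplicity (copies k J) z = (k * pm_multiplicity J z)%N.
Proof.
elim: k => [|k IH] //=.
by rewrite /copies /= /pm_multiplicity count_cat -!/(pm_multiplicity _ _) IH mulSn.
Qed.

Lemma pm_multiplicity_sum J z :
  pm_multiplicity J z = (\sum_(k < size J) (abs_Z (J`_k)%R == abs_Z z))%N.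
Proof. by rewrite pm_multiplicityE -sum1_count big_mkcond (big_nth 0) big_mkord. Qed.

End Residues.

(** * Affine maps and layer-transitivity *)

Section AffineMaps.

Variable n : nat.
Hypothesis n_gt1 : (1 < n)%N.
Implicit Types (x y z a b : 'Z_n) (J : seq 'Z_n).

Lemma GI_affine J J' (f : 'I_(size J) -> 'I_(size J')) a b :
    bijective f -> a \is a GRing.unit ->
    (forall k, abs_Z (J'`_(f k)) = abs_Z (a * J`_k)) ->
  let F (u : gi_vertex J) : gi_vertex J' := (f u.1, a * u.2 + b) in
  bijective F /\ forall u v, GI J' (F u) (F v) = GI J u v.
Proof.
move=> [g fK gK] aU fJ F; split.
  exists (fun w => (g w.1, a^-1 * (w.2 - b))) => [[k v]|[k v]] /=.
    by rewrite fK addrK mulKr.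
  by rewrite /F /= gK mulVKr // subrK.
have eqD x y : (a * x + b == a * y + b) = (x == y).
  by rewrite (inj_eq (addIr _)) (inj_eq (mulrI aU)).
move=> [k v] [l w]; rewrite /GI /gi_spoke /gi_layer /= eqD (can_eq fK).
have -> : forall c, abs_Z c = abs_Z (a * J`_k) ->
    (a * w + b == a * v + b + c) || (a * w + b == a * v + b - c)
    = (w == v + J`_k) || (w == v - J`_k).
  move=> c /eq_abs_Z[]->; rewrite ?opprK !(addrAC _ b) -?mulrBr -?mulrDr !eqD //.
  by rewrite orbC.
by [].
exact: fJ.
Qed.

(** Equal multiplicities make the lists of residues up to sign permutations of
    each other; the matching of positions is read off from such a permutation. *)
Lemma match_layers J J' a :
    a \is a GRing.unit ->
    (forall z, pm_multiplicity J' (a * z) = pm_multiplicity J z) ->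
  exists2 f : 'I_(size J) -> 'I_(size J'), bijective f &
    forall k, abs_Z (J'`_(f k)) = abs_Z (a * J`_k).
Proof.
move=> aU mJ.
pose s := [seq abs_Z (a * x) | x <- J]; pose s' := [seq abs_Z x | x <- J'].
have pe : perm_eq s s'.
  apply/allP=> z _; apply/eqP; rewrite /= !count_map.
  (* Only a z with abs_Z z = z is a value of abs_Z. *)
  have [zK|zK] := eqVneq (abs_Z z) z; last first.
    transitivity 0%N; [|symmetry]; apply/eqP; rewrite -leqn0 leqNgt -has_count;
    by apply/hasPn=> x _ /=; apply: contra zK => /eqP<-; rewrite abs_ZK.
  have := mJ (a^-1 * z); rewrite mulVKr // !pm_multiplicityE.
  rewrite {1}zK => eq_z; rewrite /preim /= eq_z; apply: eq_count => x /=.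
  rewrite -{1}zK; apply/eqP/eqP=> [|/(abs_ZM a)]; last by rewrite mulVKr.
  by move/(abs_ZM a^-1); rewrite mulKr.
have ss : size J = size J' by have := perm_size pe; rewrite !size_map.
have [Is pIs eIs] := perm_iotaP 0 pe.
have sIs : size Is = size J by rewrite (perm_size pIs) size_iota size_map ss.
have fb (k : 'I_(size J)) : (nth 0%N Is k < size J')%N.
  have : nth 0%N Is k \in Is by rewrite mem_nth ?sIs.
  by rewrite (perm_mem pIs) mem_iota size_map.
pose f k := Ordinal (fb k).
have f_inj : injective f.
  move=> k l /(congr1 val)/eqP /=; rewrite nth_uniq ?sIs //; first by move/eqP/val_inj.
  by rewrite (perm_uniq pIs) iota_uniq.
exists f; first by apply: inj_card_bij => //; rewrite !card_ord ss.
move=> k; have := congr1 (fun t => nth 0 t k) eIs.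
by rewrite (nth_map 0) // (nth_map 0%N) ?sIs // (nth_map 0) ?fb //= => <-.
Qed.

Lemma graph_iso_scale J J' a :
    a \is a GRing.unit ->
    (forall z, pm_multiplicity J' (a * z) = pm_multiplicity J z) ->
  graph_iso (GI J) (GI J').
Proof.
move=> aU /(match_layers aU)[f f_bij fJ].
by have [F_bij eF] := GI_affine 0 f_bij aU fJ; exists (fun u => (f u.1, a * u.2 + 0)).
Qed.

(** The units that permute the entries of J up to sign are transitive on these
    entries. Since only multiplicities occur, the condition passes at once to
    copies of J and to its set of entries. *)
Definition layer_transitive J : Prop :=
  forall x y, (0 < pm_multiplicity J x)%N -> (0 < pm_multiplicity J y)%N ->
    exists a, [/\ a \is a GRing.unit, abs_Z (a * x) = abs_Z y &
      forall z, pm_multiplicity J (a * z) = pm_multiplicity J z].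

Lemma pm_multiplicity_nth J (s : 'I_(size J)) : (0 < pm_multiplicity J (J`_s)%R)%N.
Proof. by rewrite pm_multiplicity_gt0 mem_nth. Qed.

Lemma layer_transitive_VT J :
  (0 < size J)%N -> layer_transitive J -> vertex_transitive (GI J).
Proof.
move=> J0 tr; apply: (vertex_transitiveI (Ordinal J0, 0)) => [[s v] [s' v']].
have [a [aU ax mJ]] := tr _ _ (pm_multiplicity_nth s) (pm_multiplicity_nth s').
have [f f_bij fJ] := match_layers aU mJ.
(* f s need not be s', but the two layers have the same entry up to sign and
   so can be interchanged. *)
pose g k := tperm (f s) s' (f k).
have g_bij : bijective g by apply: (bij_comp _ f_bij); exists (tperm (f s) s') => i; rewrite tpermK.
have gJ k : abs_Z (J`_(g k)) = abs_Z (a * J`_k).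
  rewrite /g; case: tpermP => [fk|fk|_ _]; last exact: fJ.
    by rewrite -ax -!fJ fk.
  by rewrite -fJ fk fJ ax.
have [F_bij eF] := GI_affine (v' - a * v) g_bij aU gJ.
exists (fun u => (g u.1, a * u.2 + (v' - a * v))); split=> //=.
by rewrite /g tpermL addrC subrK.
Qed.

Lemma layer_transitive_copies k J :
  layer_transitive J -> layer_transitive (copies k J).
Proof.
move=> tr x y; rewrite !pm_multiplicity_copies !muln_gt0.
move=> /andP[_ x_gt0] /andP[_ y_gt0]; have [a [aU ax mJ]] := tr x y x_gt0 y_gt0.
by exists a; split=> // z; rewrite !pm_multiplicity_copies mJ.
Qed.

Lemma layer_transitive_multiplicity J x y :
    layer_transitive J -> (0 < pm_multiplicity J x)%N ->
    (0 < pm_multiplicity J y)%N ->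
  pm_multiplicity J x = pm_multiplicity J y.
Proof.
move=> tr x_gt0 y_gt0; have [a [_ ax <-]] := tr _ _ x_gt0 y_gt0.
exact: pm_multiplicity_abs.
Qed.

End AffineMaps.

(** * Groups preserving the fundamental edge-partition *)

Section Connected.
Variable n : nat.
Hypothesis n_gt1 : (1 < n)%N.
Variable J : seq 'Z_n.
Implicit Types (x y z a b : 'Z_n) (u v w : gi_vertex J) (s : 'I_(size J)).

(** Replacing divisibility of representatives by annihilation in Z_n makes it
    visibly stable under addition and opposite. *)
Lemma mulrn_divn_eq0 d x : (d %| n)%N -> (x *+ (n %/ d) == 0) = (d %| x)%N.
Proof.
move=> d_n; rewrite -{1}[x]natr_Zp -mulrnA (natr_Z_eq0 n_gt1).
move: (nat_of_ord x) => m.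
have /dvdnP[q nE] := d_n.
have d_gt0 : (0 < d)%N by rewrite (dvdn_gt0 (ltnW n_gt1)).
have q_gt0 : (0 < q)%N by move: n_gt1; rewrite nE; case: (q).
by rewrite nE mulnK // mulnC dvdn_pmul2r.
Qed.

(** The vertices (s, v) with v divisible by d are closed under adjacency, so
    that (s, 0) cannot be joined to (s, 1) unless d = 1. *)
Lemma connected_dvdn_eq1 d :
    (0 < size J)%N -> graph_connected (GI J) -> (d %| n)%N ->
    {in J, forall x, (d %| x)%N} ->
  d = 1%N.
Proof.
move=> J_gt0 conn d_n dJ; pose s0 := Ordinal J_gt0.
have /connectP[p] := conn (s0, 0) (s0, 1).
pose D (u : gi_vertex J) := u.2 *+ (n %/ d) == 0.
have GI_D u v : GI J u v -> D u -> D v.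
  have/eqP J0 : J`_(u.1) *+ (n %/ d) == 0.
    by rewrite mulrn_divn_eq0 ?dJ ?mem_nth.
  rewrite /D => /orP[/andP[_ /eqP->] //|/andP[_ /orP[]/eqP->]].
    by rewrite mulrnDl J0 addr0.
  by rewrite mulrnBl J0 subr0.
have: D (s0, 0) by rewrite /D mul0rn.
elim: p (s0, 0) => [|v p IH] u Du /=.
  move=> _ uE; move: Du; rewrite /D -uE mulrn_divn_eq0 //= Zp_cast //.
  by rewrite modn_small // dvdn1 => /eqP.
by case/andP=> /GI_D /(_ Du); exact: IH.
Qed.

Lemma gi_layerP u v :
  reflect (v.1 = u.1 /\ (v.2 = u.2 + J`_(u.1) \/ v.2 = u.2 - J`_(u.1)))
          (gi_layer u v).
Proof.
rewrite /gi_layer eq_sym; apply: (iffP andP) => [[/eqP-> /orP[]/eqP->]|[-> [] ->]].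
- by split=> //; left.
- by split=> //; right.
- by rewrite !eqxx.
by rewrite !eqxx orbT.
Qed.

(** The image of a walk with constant step J_s is a layer walk that never
    backtracks, because p is injective and 2 J_s <> 0; so its step e, chosen
    between the two possible signs at the first edge, never changes. *)
Lemma gi_layer_walk (p : {perm gi_vertex J}) s (v : 'Z_n) :
    (forall u w, gi_layer u w -> gi_layer (p u) (p w)) ->
    J`_s != - J`_s ->
  exists2 e, abs_Z e = abs_Z (J`_((p (s, v)).1)) &
    forall k, p (s, v + J`_s *+ k) = ((p (s, v)).1, (p (s, v)).2 + e *+ k).
Proof.
move=> pL Js; set s' := (p (s, v)).1; set v' := (p (s, v)).2.
have step k : gi_layer (p (s, v + J`_s *+ k)) (p (s, v + J`_s *+ k.+1)).
  by apply/pL/gi_layerP => /=; split=> //; left; rewrite mulrS [J`_s + _]addrC addrA.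
have [e0 eE e1] : exists2 e, e = J`_s' \/ e = - J`_s' & p (s, v + J`_s *+ 1) = (s', v' + e).
  have:= step 0%N; rewrite mulr0n addr0 => /gi_layerP[].
  case: (p (s, v + _)) => s1 v1 /= -> [] ->; first by exists J`_s'; [left|].
  by exists (- J`_s'); [right|].
exists e0; first by case: eE => ->; rewrite ?abs_ZN.
suff aux k : p (s, v + J`_s *+ k) = (s', v' + e0 *+ k) /\
             p (s, v + J`_s *+ k.+1) = (s', v' + e0 *+ k.+1).
  by move=> k; case: (aux k).
elim: k => [|k [IH0 IH1]].
  by rewrite e1 !mulr0n !mulr1n !addr0 -surjective_pairing.
split=> //; have /gi_layerP[] := step k.+1; rewrite IH1 /=.
case pE: (p _) => [s2 v2] /= s2E v2E; rewrite s2E.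
suff -> : v2 = v' + e0 *+ k.+1 + e0 by rewrite (mulrS _ k.+1) [e0 + _]addrC addrA.
have: p (s, v + J`_s *+ k.+2) != p (s, v + J`_s *+ k).
  apply: contra Js; rewrite (inj_eq perm_inj) => /eqP/(congr1 snd)/=/addrI/eqP.
  by rewrite -addr_eq0 -[k.+2]addn2 mulrnDr -subr_eq0 addrC addKr mulr2n.
rewrite pE IH0 {pE} s2E.
case: eE v2E => -> [] -> //; rewrite ?opprK // => /negP[]; apply/eqP; congr pair.
  by rewrite mulrSr addrA addrK.
by rewrite mulrSr addrA subrK.
Qed.

End Connected.

Section PartitionPreserving.
Variables (n : nat) (n_gt1 : (1 < n)%N) (J : seq 'Z_n).
Hypotheses (J_gt0 : (0 < size J)%N) (J_adm : {in J, forall j, gi_admissible j})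
  (J_conn : graph_connected (GI J)).
Variable G : {group {perm gi_vertex J}}.
Hypotheses (G_trans : [transitive G, on [set: gi_vertex J] | 'P])
  (G_part : preserves_fundamental_partition G).
Implicit Types (x y z a b : 'Z_n) (u v w : gi_vertex J) (s : 'I_(size J)).

Let nth_neqN s : J`_s != - J`_s.
Proof. by rewrite -gi_admissibleE // J_adm ?mem_nth. Qed.

Let G_layer p : p \in G -> forall u v, gi_layer u v -> gi_layer (p u) (p v).
Proof. by move=> pG u v; have [_] := G_part pG u v. Qed.

(** The walk from (s, 0) closes after n / gcd(n, J_s) steps, hence so does its
    image in any other layer s': thus gcd(n, J_s) divides J_s' as well. *)
Lemma partition_preserving_unit x : x \in J -> x \is a GRing.unit.
Proof.
move=> /(nthP 0)[i i_lt <-]; pose s := Ordinal i_lt; rewrite -[i]/(nat_of_ord s).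
rewrite (unit_coprime n_gt1) /coprime; apply/eqP.
apply: (connected_dvdn_eq1 n_gt1 J_gt0 J_conn); first exact: dvdn_gcdl.
move=> _ /(nthP 0)[i' i'_lt <-]; pose s' := Ordinal i'_lt.
rewrite -[i']/(nat_of_ord s').
have [p pG ps] := vertex_transitiveE G_trans (s, 0) (s', 0).
have [e eE pe] := gi_layer_walk 0 (G_layer pG) (nth_neqN s).
have := pe (n %/ gcdn n (J`_s)%R)%N; rewrite ps /=.
have /eqP-> : J`_s *+ (n %/ gcdn n (J`_s)%R) == 0.
  by rewrite mulrn_divn_eq0 ?dvdn_gcdl ?dvdn_gcdr.
rewrite addr0 ps add0r => /(congr1 snd)/= /esym e0.
rewrite -(mulrn_divn_eq0 n_gt1) ?dvdn_gcdl //; move: eE; rewrite ps /=.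
by case/eq_abs_Z=> eE; move: e0; rewrite eE ?mulNrn => /eqP; rewrite ?oppr_eq0.
Qed.

(** Each layer being a single cycle, a layer-preserving automorphism is affine on
    it, and the spokes force the affine map to be the same on all layers. *)
Lemma partition_preserving_affine p : p \in G ->
  exists a, forall s, abs_Z (J`_((p (s, 0)).1)) = abs_Z (a * J`_s).
Proof.
move=> pG; pose s0 := Ordinal J_gt0.
have JU s : J`_s \is a GRing.unit by rewrite partition_preserving_unit ?mem_nth.
have aff s : exists2 a, abs_Z (a * J`_s) = abs_Z (J`_((p (s, 0)).1)) &
    forall x, (p (s, x)).2 = (p (s, 0)).2 + a * x.
  have [e eE pe] := gi_layer_walk 0 (G_layer pG) (nth_neqN s).
  exists (e / J`_s) => [|x]; first by rewrite mulrVK.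
  have := pe ((J`_s)^-1 * x : 'Z_n); rewrite -[J`_s *+ _]mulr_natr -[e *+ _]mulr_natr.
  rewrite natr_Zp mulVKr // add0r => -> /=.
  by rewrite mulrA.
have [a a_s0 pa] := aff s0; exists a => s.
have fib x : (p (s, x)).2 = (p (s0, x)).2.
  have [->//|ss0] := eqVneq s s0.
  have: gi_spoke (s, x) (s0, x) by rewrite /gi_spoke /= ss0 eqxx.
  by case: (G_part pG (s, x) (s0, x)) => h _ /h /andP[_ /eqP].
have [b <- pb] := aff s; suff -> : a = b by [].
by have := pb 1; rewrite !fib pa !mulr1 => /addrI.
Qed.

(** Since spokes go to spokes, p also permutes the layers; this permutation
    matches the entries of J with those of a J, up to sign. *)
Lemma partition_preserving_layer_transitive : layer_transitive J.
Proof.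
have in_J x : (0 < pm_multiplicity J x)%N -> exists s, abs_Z x = abs_Z (J`_s).
  rewrite pm_multiplicity_gt0 => /orP[] /(nthP 0)[i i_lt xE];
  exists (Ordinal i_lt); by rewrite /= xE ?abs_ZN.
move=> x y /in_J[s xE] /in_J[s' yE].
have [p pG ps] := vertex_transitiveE G_trans (s, 0) (s', 0).
have [a aE] := partition_preserving_affine pG.
have JU (k : 'I_(size J)) : J`_k \is a GRing.unit.
  by rewrite partition_preserving_unit ?mem_nth.
have as_ : abs_Z (a * J`_s) = abs_Z (J`_s') by rewrite -aE ps.
have aU : a \is a GRing.unit.
  suff: a * J`_s \is a GRing.unit by rewrite unitrMl.
  by case/eq_abs_Z: as_ => ->; rewrite ?unitrN.
exists a; split=> // [|z]; first by rewrite yE -as_; apply: abs_ZM.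
pose f k := (p (k, 0)).1.
have f_inj : injective f.
  move=> k l; apply: contra_eq => kl.
  have: gi_spoke (k, 0) (l, 0) by rewrite /gi_spoke /= kl eqxx.
  by case: (G_part pG (k, 0) (l, 0)) => h _ /h /andP[].
rewrite !pm_multiplicity_sum (reindex_inj f_inj) /=; apply: eq_bigr => k _.
rewrite aE; congr nat_of_bool; apply/eqP/eqP=> [|/(abs_ZM a)] //.
by move/(abs_ZM a^-1); rewrite !mulKr.
Qed.

End PartitionPreserving.

Section Primitive.
Variables (n : nat) (n_gt1 : (1 < n)%N) (J : seq 'Z_n) (u : 'Z_n) (k0 : nat).
Hypotheses (J_adm : {in J, forall j, gi_admissible j})
  (uJ : u \in J) (uU : u \is a GRing.unit)
  (mJ : forall x, (0 < pm_multiplicity J x)%N -> pm_multiplicity J x = k0).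

(** One entry from each pair of opposite entries of u^-1 J. *)
Definition primitive_base : {set 'Z_n} :=
  [set x | (abs_Z x == x) && (0 < pm_multiplicity J (u * x)%R)%N].

Lemma primitive_base_primitive : primitive primitive_base.
Proof.
split=> [x||x y].
- rewrite inE gi_admissibleE // => /andP[_ ux].
  suff: u * x != - (u * x) by apply: contra => /eqP xN; rewrite -mulrN -xN.
  move: ux; rewrite pm_multiplicity_gt0.
  by case/orP=> /J_adm; rewrite gi_admissibleE // ?opprK // eq_sym.
- rewrite inE mulr1 pm_multiplicity_gt0 uJ andbT /abs_Z.
  have one : (1 : 'Z_n) = 1%N :> nat by rewrite /= Zp_cast // modn_small.
  suff -> : ((1%R : 'Z_n) <= (- 1%R : 'Z_n)%R)%N by [].
  rewrite one lt0n; apply/eqP=> z; have /eqP : - (1 : 'Z_n) = 0 by apply: val_inj.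
  by rewrite oppr_eq0 oner_eq0.
rewrite !inE => /andP[/eqP xE _] /andP[/eqP yE _]; apply: contra => /eqP e.
by rewrite -xE -yE e abs_ZN.
Qed.

Lemma pm_multiplicity_primitive_base z :
  pm_multiplicity (enum primitive_base) z = (0 < pm_multiplicity J (u * z)%R)%N.
Proof.
have -> : (0 < pm_multiplicity J (u * z)%R)%N = (abs_Z z \in enum primitive_base).
  rewrite mem_enum inE abs_ZK eqxx /=; congr (0 < _)%N.
  by apply: pm_multiplicity_abs; rewrite (abs_ZM _ (abs_ZK z)).
rewrite -(count_uniq_mem _ (enum_uniq _)) pm_multiplicityE.
by apply: eq_in_count => x; rewrite mem_enum inE => /andP[/eqP-> _].
Qed.

(** Division by u carries the multiplicity k0 of an entry of J to the k0 copies
    of its representative. *)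
Lemma graph_iso_primitive_base :
  graph_iso (GI J) (GI (copies k0 (enum primitive_base))).
Proof.
apply: (@graph_iso_scale _ _ _ u^-1) => [|z]; first by rewrite unitrV.
rewrite pm_multiplicity_copies pm_multiplicity_primitive_base mulVKr //.
by case: posnP => [->|/mJ->]; rewrite ?muln0 ?muln1.
Qed.

Lemma layer_transitive_primitive_base :
  layer_transitive J -> layer_transitive (enum primitive_base).
Proof.
move=> tr x y; rewrite !pm_multiplicity_primitive_base !lt0b => ux uy.
have [a [aU ax aJ]] := tr _ _ ux uy; exists a; split=> // [|z].
  by move/(abs_ZM u^-1): ax; rewrite mulrCA !mulKr.
by rewrite !pm_multiplicity_primitive_base mulrCA aJ.
Qed.

Lemma size_primitive_base : (0 < size (enum primitive_base))%N.
Proof.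
have [_ one _] := primitive_base_primitive.
by rewrite -cardE card_gt0; apply/set0Pn; exists 1.
Qed.

End Primitive.

(** * Triangles, and the case of a single entry up to sign *)

Section Edges.
Variables (n : nat) (n_gt1 : (1 < n)%N) (J : seq 'Z_n).
Implicit Types (x y a b e : 'Z_n) (u v w z : gi_vertex J) (s k : 'I_(size J)).

(** Adjacency in a layer does not see the sign of the step, so either sign e may
    be used to describe it. *)
Lemma gi_layerE s k x y e : abs_Z e = abs_Z (J`_s) ->
  @gi_layer n J (s, x) (k, y) = (s == k) && ((y == x + e) || (y == x - e)).
Proof.
by rewrite /gi_layer /= => /eq_abs_Z[]->; rewrite ?opprK // [in RHS]orbC.
Qed.

Lemma gi_layer_ex u v :
  gi_layer u v -> exists2 e, abs_Z e = abs_Z (J`_(u.1)) & v = (u.1, u.2 + e).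
Proof.
case: v => k y /gi_layerP[/= -> [] ->]; first by exists J`_(u.1).
by exists (- J`_(u.1)); rewrite ?abs_ZN.
Qed.

Lemma GI_spoke u v : GI J u v -> u.1 != v.1 -> u.2 = v.2.
Proof. by case/orP=> /andP[]; [move=> _ /eqP | move=> ->]. Qed.

Lemma GI_layer u v : GI J u v -> u.1 = v.1 -> gi_layer u v.
Proof. by case/orP=> // /andP[/negP h _] /eqP /h. Qed.

(** If some layer edge went to a spoke, the inverse automorphism would take that
    spoke to a layer edge. *)
Lemma spokes_preserved_partition :
    (forall p, p \in graph_aut (GI J) ->
       forall u v, gi_spoke u v -> gi_spoke (p u) (p v)) ->
  preserves_fundamental_partition (graph_aut (GI J)).
Proof.
move=> pS p pA u v; split=> [|uv]; first exact: pS.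
have: GI J (p u) (p v) by rewrite (graph_autE pA) /GI uv orbT.
case/orP=> // puv; have := pS _ (groupVr pA) _ _ puv; rewrite !permK.
by move: uv => /andP[uv _] /andP[]; rewrite uv.
Qed.

Hypothesis J_adm : {in J, forall j, gi_admissible j}.

Lemma sign_neqN s e : abs_Z e = abs_Z (J`_s) -> e != - e.
Proof.
have: J`_s != - J`_s by rewrite -gi_admissibleE // J_adm ?mem_nth.
by move=> h /eq_abs_Z[] ->; rewrite // opprK eq_sym.
Qed.

Lemma sign_neq0 s e : abs_Z e = abs_Z (J`_s) -> e != 0.
Proof. by move/sign_neqN; apply: contra => /eqP->; rewrite oppr0. Qed.

(** The third vertex of a triangle on a layer edge lies in the same layer, and
    the three steps of the triangle must then all be equal. *)
Lemma gi_layer_triangle u v w :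
  gi_layer u v -> GI J u w -> GI J v w -> J`_(u.1) *+ 3 = 0.
Proof.
case: u w => s x [k y] /gi_layer_ex[e eE ->] /=.
suff h : GI J (s, x) (k, y) -> GI J (s, x + e) (k, y) -> e *+ 3 = 0.
  move=> /h{}h /h; case: (eq_abs_Z eE) => -> //.
  by rewrite mulNrn => /eqP; rewrite oppr_eq0 => /eqP.
have e0 := negP (sign_neq0 eE).
have [<-{k} uw vw|sk uw vw] := eqVneq s k; last first.
  have/= xy := GI_spoke uw sk; have/= := GI_spoke vw sk; rewrite -xy.
  by rewrite -[RHS]addr0 => /addrI/eqP/e0.
have := GI_layer vw erefl; have := GI_layer uw erefl.
rewrite !(gi_layerE _ _ _ eE) eqxx /= => /orP[]/eqP-> /orP[]/eqP.
- by rewrite -[LHS]addr0 => /addrI/esym/eqP/e0.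
- by rewrite addrK -[RHS]addr0 => /addrI/eqP/e0.
- by rewrite -addrA => /addrI/eqP; rewrite eq_sym -subr_eq0 opprK -addrA => /eqP.
by rewrite addrK -[RHS]addr0 => /addrI/eqP; rewrite oppr_eq0 => /e0.
Qed.

Lemma gi_spoke_triangle u v : (2 < size J)%N -> gi_spoke u v ->
  exists w, GI J u w /\ GI J v w.
Proof.
case: u v => s x [k y] /= J_gt2 /andP[/= sk /eqP <-].
have [t] : exists t, t \notin [set s; k].
  apply/existsP; rewrite -negb_forall; apply: contraL J_gt2 => /forallP h.
  rewrite -leqNgt -[size J]card_ord.
  apply: leq_trans (_ : #|[set s; k]| <= 2)%N; last by rewrite cards2; case: eqP.
  by apply: subset_leq_card; apply/subsetP=> t _; apply: h.
rewrite !inE negb_or => /andP[ts tk]; exists (t, x).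
by rewrite /GI /gi_spoke /= !eqxx ![_ == t]eq_sym ts tk.
Qed.

(** When there are at least three layers every spoke lies in a triangle, so all
    edges at a vertex of layer s lie in triangles exactly when 3 J_s = 0. *)
Lemma triangle_dichotomy : (2 < size J)%N -> vertex_transitive (GI J) ->
  forall s k, J`_s *+ 3 = 0 -> J`_k *+ 3 = 0.
Proof.
move=> J_gt2 vt s k s3.
have [p pA ps] := vertex_transitiveE vt (s, 0) (k, 0).
have tri v : GI J (s, 0) v -> exists w, GI J (s, 0) w /\ GI J v w.
  case/orP=> [/(gi_spoke_triangle J_gt2)//|/gi_layer_ex[e eE ->]] /=.
  exists (s, - e); rewrite /GI !(gi_layerE _ _ _ eE) eqxx /= !add0r eqxx !orbT.
  split=> //; apply/orP; right; apply/orP; left.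
  rewrite eq_sym -addr_eq0 -addrA; apply/eqP; change (e *+ 3 = 0).
  by case: (eq_abs_Z eE) => ->; rewrite ?mulNrn /= s3 ?oppr0.
have lay : gi_layer (k, 0) (k, J`_k : 'Z_n).
  by apply/gi_layerP; split=> //=; left; rewrite add0r.
pose q := (p^-1)%g; have qk : q (k, 0) = (s, 0) by rewrite -ps permK.
have qA : q \in graph_aut (GI J) by rewrite groupV.
have [] := tri (q (k, J`_k : 'Z_n)).
  by rewrite -qk (graph_autE qA) /GI lay orbT.
move=> w; rewrite -qk -[w](permK p) -/q !(graph_autE qA) => -[] .
exact: gi_layer_triangle lay.
Qed.

Lemma triangle_free_layers_partition :
    (2 < size J)%N -> (forall s, J`_s *+ 3 != 0) ->
  preserves_fundamental_partition (graph_aut (GI J)).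
Proof.
move=> J_gt2 J3; apply: spokes_preserved_partition => p pA u v uv.
have: GI J (p u) (p v) by rewrite (graph_autE pA) /GI uv.
case/orP=> // puv; have [w [uw vw]] := gi_spoke_triangle J_gt2 uv.
have := J3 (p u).1; rewrite (gi_layer_triangle puv (w := p w)) ?eqxx //.
all: by rewrite (graph_autE pA).
Qed.

(** The nonzero solutions of 3 x = 0 in Z_n are n/3 and 2n/3 = - n/3. *)
Lemma thrice_eq0_abs_Z x y : x != 0 -> y != 0 -> x *+ 3 = 0 -> y *+ 3 = 0 ->
  abs_Z x = abs_Z y.
Proof.
have third (z : 'Z_n) : z != 0 -> z *+ 3 = 0 -> ((z : nat) * 3 = n \/ (z : nat) * 3 = n * 2)%N.
  move=> z0 /eqP; rewrite -{1}[z]natr_Zp -mulrnA (natr_Z_eq0 n_gt1).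
  have := val_ltn n_gt1 z.
  have : (0 < z)%N by rewrite lt0n; apply: contra z0 => /eqP z0; apply/eqP/val_inj.
  move: (nat_of_ord z) => m m_gt0 mn /dvdnP[q qE].
  have : (q < 3)%N by nia.
  by case: q qE => [|[|[|]]] //; lia.
move=> x0 y0 /(third x x0) hx /(third y y0) hy; apply/eqP; rewrite abs_Z_eq.
have [xy|xy] : (x = y :> nat) \/ (x + y = n)%N by lia.
  by rewrite (val_inj xy) eqxx.
rewrite -[x == - y]addr_eq0 -[x in x + y]natr_Zp -[y in _ + y]natr_Zp.
by rewrite -natrD (natr_Z_eq0 n_gt1) xy dvdnn orbT.
Qed.

Hypothesis J_conn : graph_connected (GI J).

Lemma single_class_unit s0 : (forall s, abs_Z (J`_s) = abs_Z (J`_s0)) ->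
  J`_s0 \is a GRing.unit.
Proof.
move=> h; rewrite (unit_coprime n_gt1); apply/eqP.
apply: (connected_dvdn_eq1 n_gt1 _ J_conn); rewrite ?dvdn_gcdl //.
  exact: leq_trans (ltn_ord s0).
move=> _ /(nthP 0)[i i_lt <-]; pose s := Ordinal i_lt; rewrite -[i]/(nat_of_ord s).
rewrite -(mulrn_divn_eq0 n_gt1) ?dvdn_gcdl //.
have: J`_s0 *+ (n %/ gcdn n (J`_s0)%R) == 0.
  by rewrite (mulrn_divn_eq0 n_gt1) ?dvdn_gcdl ?dvdn_gcdr.
by case: (eq_abs_Z (h s)) => ->; rewrite // mulNrn oppr_eq0.
Qed.

Lemma single_class_layer_transitive s0 :
  (forall s, abs_Z (J`_s) = abs_Z (J`_s0)) -> layer_transitive J.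
Proof.
move=> h; suff aux x : (0 < pm_multiplicity J x)%N -> abs_Z x = abs_Z (J`_s0).
  move=> x y /aux xE /aux yE; exists 1; split=> [||z]; rewrite ?unitr1 ?mul1r //.
  by rewrite xE yE.
rewrite pm_multiplicity_gt0 => /orP[] /(nthP 0)[i i_lt].
  by move=> <-; rewrite (h (Ordinal i_lt)).
by rewrite -[x in abs_Z x]opprK abs_ZN => <-; rewrite (h (Ordinal i_lt)).
Qed.

End Edges.

(** * Closed walks of length 8 in a graph with two layers *)

(** A step is coded by None for a spoke and by Some d for a layer edge, taken
    forwards if d is true and backwards otherwise; flip_step is the code of the
    reversed step. *)
Definition flip_step (c : option bool) : option bool := omap negb c.

(** The state (l, al, be) stands for the vertex reached from (s, x) by a walk
    with al signed steps in layer s and be in the other layer; l tells whether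
    the walk is in layer s. *)
Definition formal_step (st : bool * int * int) (c : option bool) :=
  let: (l, al, be) := st in
  match c with
  | None => (~~ l, al, be)
  | Some d => if l then (l, al + (-1) ^+ (~~ d), be)
              else (l, al, be + (-1) ^+ (~~ d))
  end.

Definition formal_walk := foldl formal_step (true, 0, 0).

(** A non-backtracking closed walk of length 8 that passes straight through its
    starting point along layer s makes at least two steps in a row there. With
    four spokes only single layer steps would be left, so there are two spokes,
    giving the listed numbers of layer steps, or none, giving the walk around the
    layer. The finitely many codes are checked by computation. *)
Lemma formal_walk8 c1 c2 c3 c4 c5 c6 :
    let cs := [:: Some true; c1; c2; c3; c4; c5; c6; Some true] in
    sorted [rel c d | d != flip_step c] cs -> (formal_walk cs).1.1 ->
  c1 = Some true \/
  (`|(formal_walk cs).1.2|%N, `|(formal_walk cs).2|%N)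
    \in [:: (2, 4); (3, 3); (4, 2); (5, 1)]%N.
Proof.
move=> cs cs_nb cs_l; have := conj cs_nb cs_l; move/andP; rewrite {cs_nb cs_l}.
suff: (sorted [rel c d | d != flip_step c] cs && (formal_walk cs).1.1) ==>
    ((c1 == Some true) || ((`|(formal_walk cs).1.2|%N, `|(formal_walk cs).2|%N)
    \in [:: (2, 4); (3, 3); (4, 2); (5, 1)]%N)).
  by move/implyP=> h /h /orP[/eqP|]; [left | right].
rewrite {}/cs; move: c1 c2 c3 c4 c5 c6.
by do 6!case=> [[]|]; vm_compute.
Qed.

(** These are the pairs of [formal_walk8]: a closed walk of that shape would be a
    relation A a = +/- B b, whose coefficients have the divisors c and d of
    [dvdn_lincomb]. *)
Lemma coprime_divisors_excluded c d A B :
    coprime c d -> (1 < c)%N -> (1 < d)%N -> (c %| B)%N -> (d %| A)%N ->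
  (A, B) \notin [:: (2, 4); (3, 3); (4, 2); (5, 1)]%N.
Proof.
move=> cd c_gt1 d_gt1 cB dA; apply/negP; rewrite !inE.
have h k m : (0 < m)%N -> (k %| m)%N -> (k <= m)%N by move=> m0 /dvdn_leq h; exact: h.
by do 3?[case/orP]; case/eqP=> AE BE; subst A B;
  have := h _ _ _ cB; have := h _ _ _ dA; move=> /(_ isT) + /(_ isT);
  case: c cd c_gt1 cB => [|[|[|[|[|c]]]]]; case: d d_gt1 dA => [|[|[|[|[|[|d]]]]]].
Qed.

Section EightWalks.
Variables (n : nat) (n_gt1 : (1 < n)%N).
Implicit Types (x y a b : 'Z_n).

(** Multiplying the relation by n / gcd(n, x) kills x; what is left says that
    gcd(n, x) divides be y, and it is coprime to y. *)
Lemma dvdn_lincomb x y (al be : int) :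
    (forall d, (d %| n)%N -> (d %| x)%N -> (d %| y)%N -> d = 1%N) ->
    x *~ al + y *~ be = 0 ->
  (gcdn n x %| `|be|)%N.
Proof.
move=> xy1 xy0; set g := gcdn n x; have g_n : (g %| n)%N := dvdn_gcdl _ _.
have x0 : x *+ (n %/ g) = 0.
  by apply/eqP; rewrite (mulrn_divn_eq0 n_gt1) // dvdn_gcdr.
have y0 : y *~ be *~ (n %/ g)%N = 0.
  have := congr1 (fun t => t *~ (n %/ g)%N) xy0.
  by rewrite mulrzDl mul0rz [x *~ al *~ _]mulrzAC -pmulrn x0 mul0rz add0r.
have {y0} : y *+ `|be|%N *+ (n %/ g) == 0.
  case: be {xy0} y0 => m /=; first by rewrite -!pmulrn => ->.
  by rewrite NegzE mulrNz mulNrz -!pmulrn => /eqP; rewrite oppr_eq0.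
have gy : coprime g y.
  rewrite /coprime; apply/eqP/xy1; last exact: dvdn_gcdr.
    exact: dvdn_trans (dvdn_gcdl _ _) g_n.
  exact: dvdn_trans (dvdn_gcdl _ _) (dvdn_gcdr _ _).
rewrite (mulrn_divn_eq0 n_gt1) // -{1}[y]natr_Zp -mulrnA (val_Zp_nat n_gt1).
by rewrite /dvdn modn_dvdm // -/(dvdn _ _) Gauss_dvdr.
Qed.

Variable J : seq 'Z_n.
Implicit Types (u v w z : gi_vertex J) (s k : 'I_(size J)).
Variables (s s' : 'I_(size J)) (a b : 'Z_n).
Hypotheses (ss' : s != s') (s_s' : forall k, k = s \/ k = s').
Hypotheses (aE : abs_Z a = abs_Z (J`_s)) (bE : abs_Z b = abs_Z (J`_s')).

Definition step_code u v : option bool :=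
  if v.1 == u.1 then Some (v.2 == u.2 + (if u.1 == s then a else b)) else None.

Definition take_step u (c : option bool) : gi_vertex J :=
  match c with
  | None => (if u.1 == s then s' else s, u.2)
  | Some d => (u.1, u.2 + (if u.1 == s then a else b) *~ (-1) ^+ (~~ d))
  end.

Lemma take_step_code u v : GI J u v -> take_step u (step_code u v) = v.
Proof.
case: v => k y uv; rewrite /step_code /=; case: eqP => [uk|/eqP uk] /=.
  set e := if _ then _ else _.
  have eE : abs_Z e = abs_Z (J`_(u.1)).
    by rewrite /e; case: eqP => [->//|]; case: (s_s' u.1) => ->.
  move: (GI_layer uv (esym uk)); rewrite [u]surjective_pairing (gi_layerE _ _ _ eE) /=.
  case/andP=> _; rewrite uk; case: eqP => [-> _|_ /eqP->] //=.
rewrite eq_sym in uk; congr pair; last exact: GI_spoke uv uk.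
case: (s_s' u.1) (s_s' k) uk => -> [] ->; rewrite ?eqxx //.
by rewrite eq_sym (negPf ss').
Qed.

Lemma flip_stepK u c : take_step (take_step u c) (flip_step c) = u.
Proof.
case: u => k x; case: c => [d|] /=.
  by rewrite -addrA -mulrzDr; case: d; rewrite /= ?subrr ?addNr mulr0z addr0.
by case: (s_s' k) => ->; rewrite ?eqxx // [s' == s]eq_sym (negPf ss') ?eqxx.
Qed.

Definition eval_state x (st : bool * int * int) : gi_vertex J :=
  (if st.1.1 then s else s', x + a *~ st.1.2 + b *~ st.2).

Lemma eval_formal_step x st c :
  eval_state x (formal_step st c) = take_step (eval_state x st) c.
Proof.
case: st => [[[] al] be]; case: c => [d|]; rewrite /eval_state /= ?eqxx //.
- by congr pair; rewrite mulrzDr addrA [LHS]addrAC.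
- by rewrite [s' == s]eq_sym (negPf ss') mulrzDr addrA.
by rewrite [s' == s]eq_sym (negPf ss').
Qed.

Lemma formal_walkP x (w : nat -> gi_vertex J) m :
    w 0%N = (s, x) -> (forall i, (i < m)%N -> GI J (w i) (w i.+1)) ->
  w m = eval_state x (formal_walk (mkseq (fun i => step_code (w i) (w i.+1)) m)).
Proof.
move=> w0; elim: m => [|m IH] wE; first by rewrite w0 /eval_state /= !mulr0z !addr0.
rewrite mkseqS /formal_walk foldl_rcons eval_formal_step -/(formal_walk _) -IH.
  by rewrite take_step_code ?wE.
by move=> i im; apply: wE; rewrite ltnW.
Qed.

(** A closed walk of length 8 without backtracking at w 1, ..., w 7. Cycles would
    serve equally well, but absence of backtracking is a local condition that is
    simpler to check and to transport. *)
Definition closed_walk8 (T : finType) (e : rel T) (w : nat -> T) : Prop :=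
  [/\ forall i, (i < 8)%N -> e (w i) (w i.+1), w 8 = w 0%N &
      forall i, (i < 7)%N -> w i.+2 != w i].

(** A closed walk passing straight through (s, x) with step a can only go on
    around its layer: every other shape gives a relation between a and b that the
    coprime divisors gcd(n, a) and gcd(n, b) exclude. *)
Lemma closed_walk8_layer (w : nat -> gi_vertex J) x :
    (1 < gcdn n a)%N -> (1 < gcdn n b)%N ->
    (forall d, (d %| n)%N -> (d %| a)%N -> (d %| b)%N -> d = 1%N) ->
    closed_walk8 (GI J) w ->
    w 0%N = (s, x) -> w 1%N = (s, x + a) -> w 7 = (s, x - a) ->
  w 2 = (s, x + a + a).
Proof.
move=> a_gt1 b_gt1 ab1 [wE w8 w_nb] w0 w1 w7.
pose c i := step_code (w i) (w i.+1).
have c0 : c 0%N = Some true by rewrite /c w0 w1 /step_code !eqxx.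
have c7 : c 7 = Some true by rewrite /c w8 w0 w7 /step_code /= !eqxx subrK eqxx.
have c_nb : forall i, (i < 7)%N -> c i.+1 != flip_step (c i).
  move=> i i7; apply: contra (w_nb _ i7) => /eqP cE.
  rewrite -(take_step_code (wE i.+1 i7)) -/(c i.+1) cE.
  by rewrite -[X in take_step X](take_step_code (wE i (ltnW i7))) flip_stepK.
have cs_nb : sorted [rel c1 c2 | c2 != flip_step c1] (mkseq c 8).
  by rewrite /= !c_nb.
have := formal_walkP w0 wE; rewrite w8 w0 -/c.
have csE : mkseq c 8 = [:: Some true; c 1%N; c 2; c 3; c 4; c 5; c 6; Some true].
  by rewrite -{1}c0 -c7.
rewrite csE in cs_nb *; move/formal_walk8: cs_nb.
rewrite /eval_state; case: (formal_walk _) => [[l al] be] /= cs_sol -[lE xE].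
have l_true : l by case: l lE {cs_sol} => // ss; case/eqP: ss'.
have ab0 : a *~ al + b *~ be = 0 by apply: (@addrI _ x); rewrite addrA addr0 -xE.
have a_be := dvdn_lincomb ab1 ab0.
have b_al : (gcdn n b %| `|al|)%N.
  rewrite addrC in ab0; apply: dvdn_lincomb ab0 => d d_n d_b d_a; exact: ab1.
have ab_coprime : coprime (gcdn n a) (gcdn n b).
  rewrite /coprime; apply/eqP/ab1.
  - exact: dvdn_trans (dvdn_gcdl _ _) (dvdn_gcdl _ _).
  - exact: dvdn_trans (dvdn_gcdl _ _) (dvdn_gcdr _ _).
  exact: dvdn_trans (dvdn_gcdr _ _) (dvdn_gcdr _ _).
case: (cs_sol l_true) => [c1|].
  by rewrite -(take_step_code (wE 1%N isT)) -/(c 1%N) c1 w1 /= eqxx.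
by move/negP: (coprime_divisors_excluded ab_coprime a_gt1 b_gt1 a_be b_al).
Qed.

End EightWalks.

(** * Two layers without units *)

Section TwoLayers.
Variables (n : nat) (n_gt1 : (1 < n)%N) (J : seq 'Z_n).
Hypotheses (J2 : size J = 2) (J_adm : {in J, forall j, gi_admissible j})
  (J_conn : graph_connected (GI J)).
Implicit Types (x y a b : 'Z_n) (u v w z : gi_vertex J) (s t k : 'I_(size J)).

Lemma two_layersP s t : s != t -> forall k, k = s \/ k = t.
Proof.
move=> st k; have : (s != t :> nat) by [].
have := ltn_ord s; have := ltn_ord t; have := ltn_ord k; move=> ks ts ss.
have [ks'|ks' sst] := eqVneq (k : nat) s; first by left; apply: val_inj.
by right; apply: val_inj => /=; lia.
Qed.

Lemma two_layers_coprime s t a b d : s != t ->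
  abs_Z a = abs_Z (J`_s) -> abs_Z b = abs_Z (J`_t) ->
  (d %| n)%N -> (d %| a)%N -> (d %| b)%N -> d = 1%N.
Proof.
move=> st aE bE d_n d_a d_b.
apply: (connected_dvdn_eq1 n_gt1 _ J_conn) => //; first by rewrite J2.
move=> _ /(nthP 0)[i i_lt <-]; pose k := Ordinal i_lt; rewrite -[i]/(nat_of_ord k).
have sgn x y : abs_Z x = abs_Z y -> (d %| x)%N -> (d %| y)%N.
  rewrite -!(mulrn_divn_eq0 n_gt1) // => /eq_abs_Z[] -> //.
  by rewrite mulNrn oppr_eq0.
by case: (two_layersP st k) => ->; [apply: sgn d_a | apply: sgn d_b].
Qed.

Hypothesis J_nonunit : {in J, forall x, x \isn't a GRing.unit}.

Lemma nonunit_gcdn_gt1 s a : abs_Z a = abs_Z (J`_s) -> (1 < gcdn n a)%N.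
Proof.
move=> aE; rewrite ltn_neqAle gcdn_gt0 (ltnW n_gt1) andbT eq_sym.
have: J`_s \isn't a GRing.unit by apply/J_nonunit/mem_nth.
by case: (eq_abs_Z (esym aE)) => ->; rewrite ?unitrN unit_coprime.
Qed.

Lemma two_layers_neighbour s t x w : s != t ->
    GI J (s, x) w -> w != (t, x) ->
  exists2 a, abs_Z a = abs_Z (J`_s) & w = (s, x + a).
Proof.
move=> st xw wt; suff: s = w.1 by move/(GI_layer xw)/gi_layer_ex.
case: (two_layersP st w.1) => // w1; case/eqP: wt.
have /= -> : (s, x).2 = w.2 by apply: (GI_spoke xw); rewrite /= w1.
by rewrite -w1 -surjective_pairing.
Qed.

(** The walk that follows the commutator of the steps b and d, crossing a spoke
    between any two consecutive layer steps. *)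
Definition commutator_walk s t y b d : nat -> gi_vertex J :=
  nth (s, y) [:: (s, y); (t, y); (t, y + b); (s, y + b); (s, y + b + d);
                 (t, y + b + d); (t, y + d); (s, y + d); (s, y)].

Lemma closed_commutator_walk s t y b d : s != t ->
    abs_Z b = abs_Z (J`_t) -> abs_Z d = abs_Z (J`_s) ->
  closed_walk8 (GI J) (commutator_walk s t y b d).
Proof.
move=> st bE dE; have ts : t != s by rewrite eq_sym.
have spk k l x : k != l -> GI J (k, x) (l, x) by rewrite /GI /gi_spoke /= eqxx => ->.
have lay k e x x' : abs_Z e = abs_Z (J`_k) -> (x' == x + e) || (x' == x - e) ->
    GI J (k, x) (k, x').
  by move=> eE xx'; rewrite /GI (gi_layerE _ _ _ eE) eqxx xx' orbT.
have layD k e x : abs_Z e = abs_Z (J`_k) -> GI J (k, x) (k, x + e).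
  by move=> eE; apply: (lay _ _ _ _ eE); rewrite eqxx.
have layB k e x : abs_Z e = abs_Z (J`_k) -> GI J (k, x + e) (k, x).
  by move=> eE; apply: (lay _ _ _ _ eE); rewrite addrK eqxx orbT.
split=> // i.
  case: i => [|[|[|[|[|[|[|[|i]]]]]]]] //= _;
    rewrite /commutator_walk /=; try by [exact: spk | exact: layD | exact: layB].
  by rewrite addrAC; exact: layB.
case: i => [|[|[|[|[|[|[|i]]]]]]] //= _; rewrite /commutator_walk /=;
  by apply/eqP=> /(congr1 fst)/= /eqP; rewrite ?(negPf st) ?(negPf ts).
Qed.

(** Suppose that p takes a spoke at (s, x) to a layer edge at (t, y). Then the
    preimage of the spoke at (t, y) is one of the layer neighbours of (s, x), and
    the image of the other, opposite one is again a layer neighbour of (t, y). The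
    commutator walks through these two neighbours of (t, y), for both signs of b,
    pull back to two different closed walks passing straight through (s, x). *)
Lemma two_layers_partition :
  preserves_fundamental_partition (graph_aut (GI J)).
Proof.
apply: spokes_preserved_partition => p pA [s x] [s' x'] uv.
have [/= ss' /eqP xx'] := andP uv; rewrite -{x'}xx' in uv *.
have: GI J (p (s, x)) (p (s', x)) by rewrite (graph_autE pA) /GI uv.
case/orP=> //; case pu: (p (s, x)) => [t y] /gi_layerP[/= pv_layer _].
have [t' tt'] : exists t', t != t'.
  by case: (two_layersP ss' t) => ->; [exists s' | exists s]; rewrite // eq_sym.
pose q := (p^-1)%g; have qu : q (t, y) = (s, x) by rewrite -pu permK.
have qA : q \in graph_aut (GI J) by rewrite groupV.
have [a aE qz] : exists2 a, abs_Z a = abs_Z (J`_s) & q (t', y) = (s, x + a).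
  apply: (two_layers_neighbour ss').
    by rewrite -qu (graph_autE qA) /GI /gi_spoke /= tt' eqxx.
  rewrite (canF_eq (permKV p)); apply: contra tt' => /eqP z.
  by move: pv_layer; rewrite -z => /= ->.
have [d dE pl] : exists2 d, abs_Z d = abs_Z (J`_t) & p (s, x - a) = (t, y + d).
  apply: (two_layers_neighbour tt').
    by rewrite -pu (graph_autE pA) /GI (gi_layerE _ _ _ aE) !eqxx !orbT.
  rewrite -(inj_eq (@perm_inj _ q)) qz permK.
  apply/eqP=> /(congr1 snd)/addrI/eqP; rewrite eq_sym.
  exact/negP/(sign_neqN n_gt1 J_adm aE).
have qw b : abs_Z b = abs_Z (J`_t') -> q (t', y + b) = (s, x + a + a).
  move=> bE; have [wE w8 w_nb] := closed_commutator_walk y tt' bE dE.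
  have bE' : abs_Z (J`_s') = abs_Z (J`_s') by [].
  apply: (closed_walk8_layer n_gt1 ss' (two_layersP ss') aE bE'
    (nonunit_gcdn_gt1 aE) (nonunit_gcdn_gt1 bE') _
    (w := fun i => q (commutator_walk t t' y b d i))).
  - by move=> g; apply: two_layers_coprime ss' aE bE'.
  - split=> [i i8||i i7]; first by rewrite (graph_autE qA) wE.
      by rewrite w8.
    by rewrite (inj_eq perm_inj) w_nb.
  - exact: qu.
  - exact: qz.
  by rewrite /commutator_walk /= -pl permK.
have := qw (J`_t') erefl; rewrite -(qw (- J`_t')) ?abs_ZN // => /perm_inj.
move/(congr1 snd)/addrI/eqP => eqN.
by have := sign_neqN n_gt1 J_adm (erefl (abs_Z (J`_t'))); rewrite eqN.
Qed.

End TwoLayers.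

(** * The possible shapes of J, and the theorem *)

Section Multiplicities.
Variables (n : nat) (n_gt1 : (1 < n)%N) (J : seq 'Z_n).
Hypotheses (J_gt0 : (0 < size J)%N) (J_adm : {in J, forall j, gi_admissible j})
  (J_conn : graph_connected (GI J)) (J_vt : vertex_transitive (GI J)).

(** The second alternative does occur without the first: the dodecahedron
    GI(10; 1, 2) is vertex-transitive, but no unit carries 1 to 2 up to sign, and
    some of its automorphisms take spokes to layer edges. *)
Lemma layer_transitive_or_multiplicity_one :
  (layer_transitive J /\ exists2 u, u \in J & u \is a GRing.unit) \/
  (exists2 u, u \in J & u \is a GRing.unit) /\
  forall x, (0 < pm_multiplicity J x)%N -> pm_multiplicity J x = 1%N.
Proof.
pose s0 := Ordinal J_gt0.
have single : (forall s : 'I_(size J), abs_Z (J`_s) = abs_Z (J`_s0)) ->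
    layer_transitive J /\ exists2 u, u \in J & u \is a GRing.unit.
  move=> h; split; first exact: single_class_layer_transitive h.
  by exists (J`_s0); rewrite ?mem_nth ?(single_class_unit _ _ h).
have part : preserves_fundamental_partition (graph_aut (GI J)) ->
    layer_transitive J /\ exists2 u, u \in J & u \is a GRing.unit.
  move=> h; split.
    exact: (partition_preserving_layer_transitive n_gt1 J_gt0 J_adm J_conn J_vt h).
  exists (J`_s0); first exact: mem_nth.
  by apply: (partition_preserving_unit n_gt1 J_gt0 J_adm J_conn J_vt h); apply: mem_nth.
case: (ltngtP (size J) 2) => [J_lt2|J_gt2|J2].
- by left; apply: single => s; congr (abs_Z J`_ _); have := ltn_ord s => /=; lia.
- left; have [s3|s3] := eqVneq (J`_s0 *+ 3) 0.
    have all3 s := triangle_dichotomy n_gt1 J_adm J_gt2 J_vt s s3.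
    apply: single => s; apply: (thrice_eq0_abs_Z n_gt1); rewrite ?all3 //.
      exact: (sign_neq0 n_gt1 J_adm (erefl (abs_Z (J`_s)))).
    exact: (sign_neq0 n_gt1 J_adm (erefl (abs_Z (J`_s0)))).
  apply: part; apply: triangle_free_layers_partition => // s.
  apply: contra s3 => /eqP ss; apply/eqP.
  exact: (triangle_dichotomy n_gt1 J_adm J_gt2 J_vt s0 ss).
have [s1 s1E] : exists s1 : 'I_(size J), s1 = 1%N :> nat.
  have lt1 : (1 < size J)%N by rewrite J2.
  by exists (Ordinal lt1).
have s01 : s0 != s1 by apply/eqP=> e; move: s1E; rewrite -e.
have [e01|ne01] := eqVneq (abs_Z (J`_s1)) (abs_Z (J`_s0)).
  by left; apply: single => s; case: (two_layersP n_gt1 J2 s01 s) => ->.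
have [[u uJ uU]|none] : (exists2 u, u \in J & u \is a GRing.unit) \/
    {in J, forall x, x \isn't a GRing.unit}.
  have [/hasP[u uJ uU]|/hasPn h] := boolP (has (fun u => u \is a GRing.unit) J).
    by left; exists u.
  by right.
- right; split; first by exists u.
  move=> x x_gt0; apply/eqP; rewrite eqn_leq x_gt0 andbT.
  rewrite pm_multiplicity_sum (bigD1 s0) //= (bigD1 s1) 1?eq_sym //=.
  rewrite big1 ?addn0 => [|k /andP[k0 k1]].
    by do 2?case: eqP => //; move=> <- /eqP; rewrite (negPf ne01).
  by case: (two_layersP n_gt1 J2 s01 k) k0 k1 => ->; rewrite eqxx.
by left; apply: part; apply: two_layers_partition.
Qed.

End Multiplicities.

Theorem theorem19 (n : nat) (J : seq 'Z_n)
    (n_ge3 : (3 <= n)%N)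
    (J_nonempty : (1 <= size J)%N)
    (J_admissible : {in J, forall j, gi_admissible j})
    (X_connected : graph_connected (GI J))
    (X_vertex_transitive : vertex_transitive (GI J)) :
  ((exists G : {group {perm gi_vertex J}},
       [/\ G \subset graph_aut (GI J),
           [transitive G, on [set: gi_vertex J] | 'P]
         & preserves_fundamental_partition G]) ->
   forall k : nat, (0 < k)%N ->
     vertex_transitive (GI (copies k J)))
  /\
  (exists k0 : nat,
     (forall x : 'Z_n, (x \in J) || (- x \in J) -> pm_multiplicity J x = k0) /\
     exists J0 : {set 'Z_n},
       [/\ primitive J0,
           graph_iso (GI J) (GI (copies k0 (enum J0)))
         & vertex_transitive (GI (enum J0))]).
Proof.
have n_gt1 : (1 < n)%N by apply: leq_trans n_ge3.
split=> [[G [_ G_trans G_part]] [//|k] _|].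
  apply: layer_transitive_VT; first by rewrite size_cat addn_gt0 J_nonempty.
  apply: layer_transitive_copies.
  exact: (partition_preserving_layer_transitive n_gt1 J_nonempty J_admissible
    X_connected G_trans G_part).
have [[J_tr [u uJ uU]]|[[u uJ uU] J_simple]] :=
  layer_transitive_or_multiplicity_one n_gt1 J_nonempty J_admissible X_connected
    X_vertex_transitive.
- have u_gt0 : (0 < pm_multiplicity J u)%N by rewrite pm_multiplicity_gt0 uJ.
  exists (pm_multiplicity J u); split=> [x|].
    rewrite -pm_multiplicity_gt0 => x_gt0.
    exact: layer_transitive_multiplicity J_tr x_gt0 u_gt0.
  exists (primitive_base J u); split.
  - exact: primitive_base_primitive.
  - apply: graph_iso_primitive_base => // x x_gt0.
    exact: layer_transitive_multiplicity J_tr x_gt0 u_gt0.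
  apply: layer_transitive_VT.
    exact: size_primitive_base.
  exact: layer_transitive_primitive_base.
exists 1%N; split=> [x|]; first by rewrite -pm_multiplicity_gt0; apply: J_simple.
have iso := graph_iso_primitive_base uU J_simple.
exists (primitive_base J u); split=> //; first exact: primitive_base_primitive.
move: iso; rewrite /copies /= cats0 => iso.
exact: vertex_transitive_iso iso (Ordinal J_nonempty, 0) X_vertex_transitive.
Qed.
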